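(* Suppose the homogeneous odds ratio model holds: there are $\beta_0\in\mathbb{R}$ and a real-valued measurable function $\eta$ with $$\operatorname{logit} P(Y=1\mid A,U,X)=\beta_0A+\eta(U,X)\quad\text{a.s.}$$ Suppose moreover that: (1) (No effect modification by $A$ on the outcome-dependent selection) there is a positive-valued measurable function $\xi$ such that for $a=0,1$, a.s., $$\frac{P(S=1\mid Y=1,A=a,U,X)}{P(S=1\mid Y=0,A=a,U,X)}=\xi(U,X).$$ (2) (Proximal independence) $W\perp A\mid (U,X,Y,S)$ and $Z\perp (Y,W,S)\mid (A,U,X)$. (3) (Outcome confounding bridge function) $h(A,W,X)$ is a function satisfying, almost surely, $$E\{h(A,W,X)\mid A,U,X,Y=0,S=1\}=\frac{P(Y=1\mid A,U,X,S=1)}{P(Y=0\mid A,U,X,S=1)}.$$ Let $c(X)$ be an arbitrary square-integrable real-valued function such that $E\{c(X)(1-Y)h(a,W,X)\mid S=1\}\neq 0$ for $a=0,1$. Then $$E\left[c(X)(1-Y)\left\{h(1,W,X)e^{-\beta_0}-h(0,W,X)\right\}\mid S=1\right]=0 .$$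
   Context: $A$ (treatment), $Y$ (outcome), $S$ (selection indicator) are $\{0,1\}$-valued random variables; $X$ (measured covariates), $U$ (latent factors), $Z$ (treatment proxy), $W$ (outcome proxy) are random vectors, all on a common probability space. $\operatorname{logit}(p)=\log\{p/(1-p)\}$, and $\perp$ denotes (conditional) independence. Conditioning on an event such as $Y=0,S=1$ together with random variables means conditional expectation under the law given that event. Standing conventions: positivity, i.e. $P(A=a,Y=y,S=1\mid U,X)>0$ a.s. for all $a,y\in\{0,1\}$, so that all displayed ratios are well defined; the bridge function is square-integrable in the sense that $(1-Y)h(a,W,X)$ is square-integrable given $S=1$ for $a=0,1$; square-integrability of $c(X)$ is under the law given $S=1$. *)

(* Defs.v *)
From HB Require Import structures.
From mathcomp Require Import all_boot all_order all_algebra.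
From mathcomp Require Import all_classical all_reals all_analysis.
From mathcomp Require Import measurable_realfun.

Set Implicit Arguments.
Unset Strict Implicit.
Unset Printing Implicit Defensive.

Import Order.TTheory GRing.Theory Num.Theory.
Import numFieldNormedType.Exports.

Local Open Scope classical_set_scope.
Local Open Scope ring_scope.

Definition logit (R : realType) (p : R) : R := ln (p / (1 - p)).

(* The law B |-> P (B `&` E) / P E. When E is not measurable or P E = 0, the
   value is P by convention. *)
Definition condlaw d (T : measurableType d) (R : realType)
    (P : probability T R) (E : set T) : probability T R :=
  match pselect (measurable E) with
  | left mE => mnormalize (mrestr P mE) P
  | right _ => P
  end.

(* g (V) is a version of the conditional expectation of f given V; the
   sigma-algebra generated by V consists of the sets V @^-1` C. *)
Definition is_cexp d d' (T : measurableType d) (T' : measurableType d')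
    (R : realType) (P : probability T R) (V : T -> T') (f : T -> R)
    (g : T' -> R) : Prop :=
  [/\ measurable_fun setT g,
      P.-integrable setT (EFin \o (g \o V)) &
      forall C : set T', measurable C ->
        (\int[P]_(w in V @^-1` C) (g (V w))%:E =
         \int[P]_(w in V @^-1` C) (f w)%:E)%E].

(* A version of E[f | V], as a random variable; it is the constant 0 when there
   is no version, which cannot happen for integrable f (see cexpP). *)
Definition cexp d d' (T : measurableType d) (T' : measurableType d')
    (R : realType) (P : probability T R) (V : T -> T') (f : T -> R) : T -> R :=
  xget (cst 0) [set g : T' -> R | is_cexp P V f g] \o V.

Definition cprob d d' (T : measurableType d) (T' : measurableType d')
    (R : realType) (P : probability T R) (V : T -> T') (E : set T) : T -> R :=
  cexp P V \1_E.

Definition cindep d d1 d2 d3 (T : measurableType d) (T1 : measurableType d1)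
    (T2 : measurableType d2) (T3 : measurableType d3) (R : realType)
    (P : probability T R) (F : T -> T1) (G : T -> T2) (V : T -> T3) : Prop :=
  forall (B : set T1) (C : set T2), measurable B -> measurable C ->
    {ae P, forall w, cprob P V (F @^-1` B `&` G @^-1` C) w =
                     cprob P V (F @^-1` B) w * cprob P V (G @^-1` C) w}.

Lemma condlawE d (T : measurableType d) (R : realType) (P : probability T R)
    (E B : set T) : measurable E -> P E != 0%E ->
  condlaw P E B = (P (B `&` E) * (fine (P E))^-1%:E)%E.
Proof.
move=> mE PE; rewrite /condlaw; case: pselect => // mE'.
rewrite /= /mnormalize /=.
have -> : mrestr P mE' setT = P E by rewrite /mrestr setTI.
by rewrite (negbTE PE) /= lt_eqF// ltey_eq fin_num_measure.
Qed.

Lemma cexpP d d' (T : measurableType d) (T' : measurableType d')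
    (R : realType) (P : probability T R) (V : T -> T') (f : T -> R) :
  measurable_fun setT V -> P.-integrable setT (EFin \o f) ->
  is_cexp P V f (xget (cst 0) [set g : T' -> R | is_cexp P V f g]).
Proof.
move=> mV intf.
suff ex : exists g, is_cexp P V f g.
  exact: (@xgetPex _ (cst 0) [set g | is_cexp P V f g]).
pose V' : {mfun T >-> T'} := HB.pack V (isMeasurableFun.Build _ _ _ _ V mV).
have mpre C : measurable C -> measurable (V @^-1` C).
  by move=> mC; rewrite -[X in measurable X]setTI; exact: (mV).
pose nu : {charge set T' -> \bar R} :=
  @measure_function_pushforward__canonical__charge_Charge _ _ _ _ V R
    (induced_charge intf) mV.
have nuE C : nu C = (\int[P]_(w in V @^-1` C) (f w)%:E)%E by [].
pose mu := distribution P V'.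
have numu : nu `<< mu.
  apply/null_content_dominatesP => C mC muC; rewrite nuE.
  apply: null_set_integral => //; first exact: mpre.
  exact: measurable_funS (measurable_int _ intf).
pose k := Radon_Nikodym nu mu.
have kfin x : k x \is a fin_num by exact: Radon_Nikodym_fin_num.
have ik : mu.-integrable setT k by exact: Radon_Nikodym_integrable.
have kV : EFin \o ((fine \o k) \o V) = k \o V.
  by apply/funext => w /=; rewrite fineK.
have mk : measurable_fun setT k by exact: measurable_int ik.
have ikV : P.-integrable setT (k \o V).
  apply/integrableP; split; first exact: measurableT_comp.
  have /integrableP[_] := ik.
  rewrite /mu ge0_integral_pushforward//.
  exact: measurableT_comp.
exists (fine \o k); split.
- exact: measurableT_comp.
- by rewrite kV.
move=> C mC; rewrite -nuE (Radon_Nikodym_integral numu mC) -/k.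
rewrite /mu integral_pushforward//=.
  by apply: eq_integral => w _; rewrite /= fineK.
by apply: integrableS ikV => //; exact: mpre.
Qed.

(* Main.v *)
(* Write V = (U, X), r_a(V) = xi(V) exp(beta0 a + eta(V)), and f ~ g when
   E[f - g | V] = 0. The outcome model and the selection condition give
   1{A=a} S Y ~ 1{A=a} S (1 - Y) r_a(V), and the bridge equation gives
   1{A=a} S Y ~ 1{A=a} S (1 - Y) h(a, W, X); hence
   1{A=a} S (1 - Y) (h(a, W, X) - r_a(V)) ~ 0. As W is independent of A given
   (U, X, Y, S), the factor 1{A=a} may be replaced by
   P(A = a | V, Y = 0, S = 1), which is nonzero by positivity and depends on V
   only, so it cancels. Since r_1 = exp(beta0) r_0, it follows that
   S (1 - Y) (exp(-beta0) h(1, W, X) - h(0, W, X)) ~ 0, and c(X) is a function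
   of V. All these relations are used up to factors in V that need not be
   integrable, so conditional centering is defined through a positive weight. *)

Require Import Defs.
From HB Require Import structures.
From mathcomp Require Import all_boot all_order all_algebra.
From mathcomp Require Import all_classical all_reals all_analysis.
From mathcomp Require Import measurable_realfun finmap ring.
Set Implicit Arguments.
Unset Strict Implicit.
Unset Printing Implicit Defensive.
Import Order.TTheory GRing.Theory Num.Theory.
Import numFieldNormedType.Exports.
Local Open Scope classical_set_scope.
Local Open Scope ring_scope.
Import HBNNSimple.

(** * Integration preliminaries and the pull-out property *)

Lemma measurable_preimage d d' (T : measurableType d) (T' : measurableType d')
    (V : T -> T') (C : set T') :
  measurable_fun setT V -> measurable C -> measurable (V @^-1` C).
Proof. by move=> mV mC; rewrite -[X in measurable X]setTI; exact: mV. Qed.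

Lemma integral_indicM (R : realType) d (T : measurableType d)
    (P : {measure set T -> \bar R}) (D E : set T) (f : T -> R) :
  (\int[P]_(x in D `&` E) (f x)%:E = \int[P]_(x in D) (\1_E x * f x)%:E)%E.
Proof.
rewrite integral_mkcondr; apply: eq_integral => x _.
by rewrite patchE indicE; case: (x \in E); rewrite ?mul1r ?mul0r.
Qed.

Lemma le_integrable_real (R : realType) d (T : measurableType d)
    (P : {measure set T -> \bar R}) (f g : T -> R) :
  measurable_fun setT f -> (forall x, `|f x| <= `|g x|) ->
  P.-integrable setT (EFin \o g) -> P.-integrable setT (EFin \o f).
Proof.
move=> mf fg; apply: le_integrable => //; first exact/measurable_EFinP.
by move=> x _; rewrite /= lee_fin.
Qed.

(** For simple [k] the integral is a finite combination of integrals of [f] over events of [V].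
    Nonnegative [k] follows by dominated convergence with bound [|k (V) f|], signed [k] by splitting
    into positive and negative parts. *)
Lemma integral_pullout0 (R : realType) d d' (T : measurableType d)
    (T' : measurableType d') (P : {measure set T -> \bar R}) (V : T -> T')
    (f : T -> R) (k : T' -> R) :
  measurable_fun setT V -> P.-integrable setT (EFin \o f) ->
  (forall C, measurable C -> \int[P]_(t in V @^-1` C) (f t)%:E = 0)%E ->
  measurable_fun setT k ->
  P.-integrable setT (EFin \o (fun t => k (V t) * f t)) ->
  (\int[P]_t (k (V t) * f t)%:E = 0)%E.
Proof.
move=> mV intf f0 mk ik.
have mf : measurable_fun setT f by apply/measurable_EFinP/(measurable_int _ intf).
have pos (l : T' -> R) : (forall v, 0 <= l v) -> measurable_fun setT l ->
    P.-integrable setT (EFin \o (fun t => l (V t) * f t)) ->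
    (\int[P]_t (l (V t) * f t)%:E = 0)%E.
  move=> l0 ml il.
  have mEl : measurable_fun setT (EFin \o l) by exact/measurable_EFinP.
  pose a := nnsfun_approx measurableT mEl.
  have al n v : 0 <= a n v <= l v.
    apply/andP; split; first exact: fun_ge0.
    rewrite -lee_fin nnsfun_approxE.
    by apply: (@le_approx _ _ _ setT (EFin \o l)) => // x _; rewrite lee_fin.
  have a0 n : (\int[P]_t (a n (V t) * f t)%:E = 0)%E.
    transitivity (\int[P]_t (\sum_(y <- fset_set (range (a n)))
        (y * (\1_(V @^-1` (a n @^-1` [set y])) t * f t))%:E))%E.
      apply: eq_integral => t _; rewrite sumEFin; congr EFin.
      rewrite (fimfunE (a n)) fsbig_finite//= mulr_suml; apply: eq_bigr => i _.
      by rewrite mulrA.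
    have mA r : measurable (V @^-1` (a n @^-1` [set r])).
      by apply: measurable_preimage.
    have iA r : P.-integrable setT
        (EFin \o (fun t => \1_(V @^-1` (a n @^-1` [set r])) t * f t)).
      apply: le_integrable_real intf; first by apply: measurable_funM.
      move=> t; rewrite indicE; case: (_ \in _); rewrite ?mul1r// mul0r normr0.
      exact: normr_ge0.
    rewrite integral_sum//.
      apply: big1 => i _.
      under eq_integral do rewrite EFinM.
      rewrite integralZl//; last exact: iA.
      by rewrite -integral_indicM setTI f0 ?mule0.
    move=> y.
    by apply: (@integrableZl _ _ _ _ _ measurableT y) (iA y).
  have mla n : measurable_fun setT (fun t => (a n (V t) * f t)%:E).
    by apply/measurable_EFinP; apply: measurable_funM => //; apply: measurableT_comp.
  have mVl : measurable_fun setT (fun t => (l (V t) * f t)%:E).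
    exact: (measurable_int _ il).
  have a_l : {ae P, forall t, setT t ->
      (a n (V t) * f t)%:E @[n --> \oo] --> (l (V t) * f t)%:E}.
    apply: aeW => t _; apply: cvg_EFin; first exact: nearW.
    apply: cvgMl.
    have := @cvg_nnsfun_approx _ _ _ _ measurableT _ mEl.
    move=> /(_ _ (V t) Logic.I) al0.
    by have /fine_cvgP[_] := al0 (fun x _ => l0 x).
  have a_le : {ae P, forall t n, setT t ->
      (`|(a n (V t) * f t)%:E| <= `|(l (V t) * f t)%:E|)%E}.
    apply: aeW => t n _; rewrite lee_fin !normrM ler_wpM2r//.
    by have /andP[a1 a2] := al n (V t); rewrite !ger0_norm.
  have [_ _] := dominated_convergence measurableT mla mVl a_l
    (integrable_abse il) a_le.
  under eq_fun do rewrite a0.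
  by move=> /cvg_lim => /(_ (@ereal_hausdorff _)) <-; rewrite lim_cst.
have kpn t : k t = k^\+ t - k^\- t by rewrite -[in LHS](funrposBneg k).
have ip : P.-integrable setT (EFin \o (fun t => k^\+ (V t) * f t)).
  apply: le_integrable_real ik.
    apply: measurable_funM => //; apply: measurableT_comp => //.
    exact: measurable_funrpos.
  move=> t; rewrite !normrM ler_wpM2r// -[leRHS]/((Num.norm \o k) (V t)).
  by rewrite -funrposDneg ger0_norm ?funrpos_ge0// lerDl funrneg_ge0.
have ineg : P.-integrable setT (EFin \o (fun t => k^\- (V t) * f t)).
  apply: le_integrable_real ik.
    apply: measurable_funM => //; apply: measurableT_comp => //.
    exact: measurable_funrneg.
  move=> t; rewrite !normrM ler_wpM2r// -[leRHS]/((Num.norm \o k) (V t)).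
  by rewrite -funrposDneg ger0_norm ?funrneg_ge0// lerDr funrpos_ge0.
under eq_integral do rewrite kpn mulrBl EFinB.
rewrite integralB_EFin// (pos k^\+ (funrpos_ge0 k) (measurable_funrpos mk))//.
by rewrite (pos k^\- (funrneg_ge0 k) (measurable_funrneg mk))// sube0.
Qed.

(** * Integration against a conditional law *)

Lemma ge0_integral_condlaw (R : realType) d (T : measurableType d)
    (P : probability T R) (E D : set T) (f : T -> \bar R) :
  measurable E -> P E != 0%E -> measurable D -> measurable_fun setT f ->
  (forall x, 0 <= f x)%E ->
  (\int[condlaw P E]_(x in D) f x =
   (fine (P E))^-1%:E * \int[P]_(x in D `&` E) f x)%E.
Proof.
move=> mE PE mD mf f0.
have k0 : 0 <= (fine (P E))^-1 by rewrite invr_ge0 fine_ge0.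
(* The complement of [E] is null under [condlaw P E]; inside [E] this law is [P] scaled by
   [1 / P E]. *)
rewrite (@ge0_negligible_integral _ _ _ _ D (~` E))//; first last.
- by apply: etrans (condlawE _ mE PE) _; rewrite setICl measure0 mul0e.
- exact: measurable_funS mf.
- exact: measurableC.
rewrite setDE setCK (eq_measure_integral (mscale (NngNum k0) P)); last first.
  move=> A mA AE; apply: etrans (condlawE _ mE PE) _.
  rewrite /mscale/= muleC setIidl//.
  by apply: subset_trans AE _; exact: subIsetr.
rewrite ge0_integral_mscale//; first exact: measurableI.
exact: measurable_funS mf.
Qed.

(** The two integrals of absolute values differ by the finite positive factor [1 / P E], so they are
    finite together. *)
Lemma condlaw_integrable (R : realType) d (T : measurableType d)
    (P : probability T R) (E : set T) (f : T -> R) :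
  measurable E -> P E != 0%E -> measurable_fun setT f ->
  (condlaw P E).-integrable setT (EFin \o f) <->
  P.-integrable setT (EFin \o (fun t => \1_E t * f t)).
Proof.
move=> mE PE mf.
have k0 : 0 < (fine (P E))^-1.
  by rewrite invr_gt0 fine_gt0// lt0e PE measure_ge0 ltey_eq fin_num_measure.
have mEf : measurable_fun setT (EFin \o f) by exact/measurable_EFinP.
have H : ((\int[condlaw P E]_t `|(f t)%:E|) < +oo <->
    (\int[P]_t `|(\1_E t * f t)%:E|) < +oo)%E.
  rewrite (@ge0_integral_condlaw _ _ _ P E setT (fun t => `|(f t)%:E|%E))//; last first.
    by apply/measurable_EFinP; exact: measurableT_comp.
  rewrite (@integral_indicM _ _ _ P setT E (fun t => `|f t|)).
  under eq_integral => t _ do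
    rewrite -[\1_E t]ger0_norm// -normrM -[(_)%:E]/(`|(\1_E t * f t)%:E|)%E.
  have := @integral_ge0 _ _ _ P setT (fun t => `|(\1_E t * f t)%:E|)%E
    (fun t _ => abse_ge0 _).
  case: (\int[P]_t `|(\1_E t * f t)%:E|)%E => [r _| |]//.
    by rewrite -EFinM !ltry.
  by rewrite gt0_muley ?lte_fin.
have mEf1 : measurable_fun setT (EFin \o (fun t => \1_E t * f t)).
  by apply/measurable_EFinP/measurable_funM.
split=> /integrableP[_ i]; apply/integrableP; split => //; exact/H.
Qed.

Lemma integral_condlaw (R : realType) d (T : measurableType d)
    (P : probability T R) (E D : set T) (f : T -> R) :
  measurable E -> P E != 0%E -> measurable D ->
  measurable_fun setT f -> 
  (condlaw P E).-integrable setT (EFin \o f) ->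
  (\int[condlaw P E]_(x in D) (f x)%:E =
   (fine (P E))^-1%:E * \int[P]_(x in D) (\1_E x * f x)%:E)%E.
Proof.
move=> mE PE mD mf intf; rewrite -integral_indicM.
have mEf : measurable_fun setT (fun t => (f t)%:E) by exact/measurable_EFinP.
rewrite [LHS]integralE [X in (_ = _ * X)%E]integralE.
rewrite (ge0_integral_condlaw mE PE mD (measurable_funepos mEf) (funepos_ge0 _)).
rewrite (ge0_integral_condlaw mE PE mD (measurable_funeneg mEf) (funeneg_ge0 _)).
(* Distributing over the difference requires that [+oo - +oo] does not occur, which integrability on
   the part of [D] inside [E] ensures. *)
rewrite -muleBr// integrable_add_def//; first exact: measurableI.
move: intf => /(condlaw_integrable mE PE mf) intf.
apply: (eq_integrable _ (fun t => (\1_E t * f t)%:E)).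
- exact: measurableI.
- by move=> x /set_mem[_ Ex]; rewrite indicE mem_set// mul1r.
- by apply: integrableS intf => //; exact: measurableI.
Qed.

(* E[f | V] = 0 for an [f] that need not be integrable: the weight makes this
   closed under multiplication by arbitrary measurable functions of [V]. *)
Definition cmean0 d d' (T : measurableType d) (T' : measurableType d')
    (R : realType) (P : probability T R) (V : T -> T') (f : T -> R) : Prop :=
  exists w : T' -> R,
    [/\ measurable_fun setT w, (forall v, 0 < w v <= 1),
        P.-integrable setT (EFin \o (fun t => w (V t) * f t)) &
        forall C, measurable C ->
          (\int[P]_(t in V @^-1` C) (w (V t) * f t)%:E = 0)%E].

Lemma measurable_inv (R : realType) d (T : measurableType d) (w : T -> R) :
  measurable_fun setT w -> measurable_fun setT (fun t => (w t)^-1).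
Proof.
move=> mw.
(* also valid where [w t = 0], since [0^-1 = 0] *)
rewrite (_ : (fun t => _) = fun t => w t * expR (- ln (w t * w t))).
  apply: measurable_funM => //; apply: measurableT_comp => //.
  by apply: measurable_funN; apply: measurableT_comp => //; exact: measurable_funM.
apply/funext => t; have [->|w0] := eqVneq (w t) 0; first by rewrite invr0 mul0r.
have w2 : 0 < w t * w t by rewrite lt0r mulf_neq0//= sqr_ge0.
by rewrite expRN lnK ?posrE// invfM mulVKf.
Qed.

(** * Calculus of conditional centering *)

Section cmean0_theory.
Context (d d' : measure_display) (T : measurableType d) (T' : measurableType d')
  (R : realType) (P : probability T R).
Implicit Types (V : T -> T') (f g : T -> R).

Lemma cmean0_measurable V f :
  measurable_fun setT V -> cmean0 P V f -> measurable_fun setT f.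
Proof.
move=> mV [w [mw w01 iw _]].
rewrite (_ : f = fun t => (w (V t))^-1 * (w (V t) * f t)).
  apply: measurable_funM; last exact/measurable_EFinP/(measurable_int _ iw).
  by apply: measurable_inv; exact: measurableT_comp.
apply/funext => t; rewrite mulKf//.
by have /andP[/lt0r_neq0] := w01 (V t).
Qed.

(** Since [w] is positive, [k f = (k / w) (w f)], and the pull-out property applies to the
    integrable [w f]. Later arguments thereby become independent of the particular weight. *)
Lemma cmean0_integral V f (k : T' -> R) :
  measurable_fun setT V -> cmean0 P V f -> measurable_fun setT k ->
  P.-integrable setT (EFin \o (fun t => k (V t) * f t)) ->
  (\int[P]_t (k (V t) * f t)%:E = 0)%E.
Proof.
move=> mV [w [mw w01 iw w0]] mk ik.
have E t : k (V t) * f t = (k (V t) / w (V t)) * (w (V t) * f t).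
  by rewrite mulrA divfK//; have /andP[/lt0r_neq0] := w01 (V t).
under eq_integral do rewrite E.
apply: (@integral_pullout0 _ _ _ _ _ P V _ (fun v => k v / w v)) => //.
- by apply: measurable_funM => //; exact: measurable_inv.
- by apply: eq_integrable ik => // t _; rewrite /= E.
Qed.

Lemma cmean0P V f (w : T' -> R) :
  measurable_fun setT V -> measurable_fun setT w -> (forall v, 0 < w v) ->
  P.-integrable setT (EFin \o (fun t => w (V t) * f t)) ->
  (forall k : T' -> R, measurable_fun setT k ->
     P.-integrable setT (EFin \o (fun t => k (V t) * f t)) ->
     (\int[P]_t (k (V t) * f t)%:E = 0)%E) ->
  cmean0 P V f.
Proof.
move=> mV mw w0 iw H.
(* [w / (1 + w)] lies below both 1 and [w]: the first bound is the one imposed on weights by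
   [cmean0], the second keeps [u (V) f] integrable. *)
pose u v := w v * (1 + w v)^-1.
have mu : measurable_fun setT u.
  apply: measurable_funM => //; apply: measurable_inv.
  exact: measurable_funD.
have w1 v : 0 < 1 + w v by rewrite addr_gt0.
have u01 v : 0 < u v <= 1.
  by rewrite divr_gt0//= ler_pdivrMr// mul1r lerDr ler01.
have uw v : u v <= w v.
  rewrite ler_pdivrMr// mulrDr mulr1 lerDl; exact/mulr_ge0/ltW/w0/ltW/w0.
have mf : measurable_fun setT f.
  rewrite (_ : f = fun t => (w (V t))^-1 * (w (V t) * f t)).
    apply: measurable_funM; last exact/measurable_EFinP/(measurable_int _ iw).
    by apply: measurable_inv; exact: measurableT_comp.
  by apply/funext => t; rewrite mulKf// gt_eqF.
have iu : P.-integrable setT (EFin \o (fun t => u (V t) * f t)).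
  apply: le_integrable_real iw.
    by apply: measurable_funM => //; exact: measurableT_comp.
  move=> t; have /andP[u0 _] := u01 (V t).
  by rewrite !(normrM _ (f t)) ler_wpM2r// !gtr0_norm.
exists u; split => // C mC.
rewrite -[_ @^-1` _]setTI integral_indicM.
under eq_integral do rewrite mulrA.
have mCu : measurable_fun setT (fun v => \1_C v * u v).
  by apply: measurable_funM => //; exact: measurable_indic.
apply: (H (fun v => \1_C v * u v)) => //.
apply: le_integrable_real iu.
  by apply: measurable_funM => //; exact: (measurableT_comp mCu mV).
move=> t; rewrite indicE; case: (_ \in _); rewrite ?mul1r// !mul0r normr0.
exact: normr_ge0.
Qed.

Lemma cmean0_int V f :
  measurable_fun setT V -> P.-integrable setT (EFin \o f) ->
  (forall C, measurable C -> \int[P]_(t in V @^-1` C) (f t)%:E = 0)%E ->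
  cmean0 P V f.
Proof.
move=> mV intf f0; exists (cst 1); split => //.
- by move=> v; rewrite ltr01 lexx.
- by apply: eq_integrable intf => // t _; rewrite /= mul1r.
- by move=> C mC; under eq_integral do rewrite mul1r; exact: f0.
Qed.

(** The new weight [w / (1 + |m|)] absorbs the growth of [m]. *)
Lemma cmean0M V f (m : T' -> R) :
  measurable_fun setT V -> measurable_fun setT m ->
  cmean0 P V f -> cmean0 P V (fun t => m (V t) * f t).
Proof.
move=> mV mm cf; have [w [mw w01 iw w0]] := cf.
have mf := cmean0_measurable mV cf.
have m1 v : 0 < 1 + `|m v| by rewrite ltr_pwDl.
have mm1 : measurable_fun setT (fun v => (1 + `|m v|)^-1).
  by apply: measurable_inv; apply: measurable_funD => //; exact: measurableT_comp.
have mwm : measurable_fun setT (fun v => w v / (1 + `|m v|)).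
  exact: measurable_funM.
apply: (@cmean0P _ _ (fun v => w v / (1 + `|m v|))) => //.
- by move=> v; rewrite divr_gt0//; have /andP[] := w01 v.
- apply: le_integrable_real iw.
    apply: measurable_funM.
      exact: (measurableT_comp mwm mV).
    by apply: measurable_funM => //; exact: measurableT_comp.
  move=> t; rewrite mulrA !normrM ler_wpM2r// -mulrA ler_piMr//.
  by rewrite normfV (gtr0_norm (m1 _)) mulrC ler_pdivrMr// mul1r lerDr.
- move=> k mk; have E t : k (V t) * (m (V t) * f t) = (k (V t) * m (V t)) * f t.
    by rewrite mulrA.
  move=> ik; under eq_integral do rewrite E.
  have mkm : measurable_fun setT (fun v => k v * m v) by exact: measurable_funM.
  apply: (cmean0_integral mV cf mkm).
  by apply: eq_integrable ik => // t _; rewrite /= E.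
Qed.

(** The product of the two weights serves both summands, because each weight is at most 1; this is
    the purpose of the upper bound in [cmean0]. *)
Lemma cmean0D V f g : measurable_fun setT V ->
  cmean0 P V f -> cmean0 P V g -> cmean0 P V (fun t => f t + g t).
Proof.
move=> mV cf cg.
have mf := cmean0_measurable mV cf; have mg := cmean0_measurable mV cg.
have [w1 [mw1 w101 iw1 _]] := cf; have [w2 [mw2 w201 iw2 _]] := cg.
have mw : measurable_fun setT (fun v => w1 v * w2 v) by exact: measurable_funM.
have if' : P.-integrable setT (EFin \o (fun t => w1 (V t) * w2 (V t) * f t)).
  apply: le_integrable_real iw1.
    by apply: measurable_funM => //; exact: (measurableT_comp mw mV).
  move=> t; rewrite -mulrA !normrM ler_wpM2l// ler_piMl//.
  by have /andP[h1 h2] := w201 (V t); rewrite gtr0_norm.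
have ig' : P.-integrable setT (EFin \o (fun t => w1 (V t) * w2 (V t) * g t)).
  apply: le_integrable_real iw2.
    by apply: measurable_funM => //; exact: (measurableT_comp mw mV).
  move=> t; rewrite -mulrA !normrM ler_piMl ?mulr_ge0//.
  by have /andP[h1 h2] := w101 (V t); rewrite gtr0_norm.
exists (fun v => w1 v * w2 v); split => //.
- move=> v; have /andP[h1 h2] := w101 v; have /andP[h3 h4] := w201 v.
  by rewrite mulr_gt0//= mulr_ile1// ltW.
- by apply: eq_integrable (integrableD measurableT if' ig') => // t _; rewrite /= mulrDr.
move=> C mC; have mVC := measurable_preimage mV mC.
rewrite -[_ @^-1` _]setTI integral_indicM.
have mCw : measurable_fun setT (fun v => \1_C v * (w1 v * w2 v)).
  by apply: measurable_funM => //; exact: measurable_indic.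
have ind f' : measurable_fun setT f' ->
    P.-integrable setT (EFin \o (fun t => w1 (V t) * w2 (V t) * f' t)) ->
    P.-integrable setT
      (EFin \o (fun t => \1_C (V t) * (w1 (V t) * w2 (V t)) * f' t)).
  move=> mf'; apply: le_integrable_real.
    by apply: measurable_funM => //; exact: (measurableT_comp mCw mV).
  move=> t; rewrite indicE; case: (_ \in _); rewrite ?mul1r// !mul0r normr0.
  exact: normr_ge0.
under eq_integral do rewrite mulrA mulrDr EFinD.
rewrite integralD_EFin//; [|exact: ind|exact: ind].
rewrite (cmean0_integral mV cf mCw (ind _ mf if')).
by rewrite (cmean0_integral mV cg mCw (ind _ mg ig')) adde0.
Qed.

Lemma cmean0B V f g : measurable_fun setT V ->
  cmean0 P V f -> cmean0 P V g -> cmean0 P V (fun t => f t - g t).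
Proof.
move=> mV cf cg; apply: cmean0D => //.
rewrite (_ : (fun t => _) = fun t => cst (-1) (V t) * g t); first exact: cmean0M.
by apply/funext => t; rewrite mulN1r.
Qed.

Lemma cmean0_ae V f g : measurable_fun setT V -> measurable_fun setT g ->
  {ae P, forall t, f t = g t} -> cmean0 P V f -> cmean0 P V g.
Proof.
move=> mV mg fg cf; have mf := cmean0_measurable mV cf.
have [w [mw w01 iw w0]] := cf.
have mwf : measurable_fun setT (fun t => w (V t) * f t).
  by apply: measurable_funM => //; exact: measurableT_comp.
have mwg : measurable_fun setT (fun t => w (V t) * g t).
  by apply: measurable_funM => //; exact: measurableT_comp.
exists w; split => //.
- apply/integrableP; split; first exact/measurable_EFinP.
  have /integrableP[_] := iw.
  rewrite [X in (X < _)%E -> _](@ge0_ae_eq_integral _ _ _ _ _ _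
    (fun t => `|(w (V t) * g t)%:E|%E))//.
  + by apply/measurable_EFinP; exact: measurableT_comp.
  + by apply/measurable_EFinP; exact: measurableT_comp.
  + by apply: (filterS _ fg) => t /= ->.
- move=> C mC; rewrite -(w0 _ mC); apply: ae_eq_integral => //.
  + exact: measurable_preimage.
  + by apply: measurable_funTS; exact/measurable_EFinP.
  + by apply: measurable_funTS; exact/measurable_EFinP.
  by apply: filterS fg => t /= ->.
Qed.

(** The nonnegative function [w (V) f] has total integral 0, hence vanishes almost surely, and [w]
    is positive. *)
Lemma cmean0_ge0 V f : measurable_fun setT V ->
  cmean0 P V f -> (forall t, 0 <= f t) -> {ae P, forall t, f t = 0}.
Proof.
move=> mV [w [mw w01 iw w0]] f0.
have := w0 setT measurableT; rewrite preimage_setT => I0.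
have /ae_eq_integral_abs : measurable_fun setT (EFin \o (fun t => w (V t) * f t)).
  exact: measurable_int iw.
move=> /(_ P measurableT)[+ _].
have E t : (`|(EFin \o (fun t => (w (V t) * f t)%R)) t| = (w (V t) * f t)%:E)%E.
  by rewrite /= ger0_norm// mulr_ge0//; have /andP[/ltW] := w01 (V t).
under eq_integral do rewrite E.
move=> /(_ I0); apply: filterS => t /= /(_ Logic.I) [] /eqP.
rewrite mulf_eq0 => /orP[/eqP|/eqP//].
by have /andP[/lt0r_neq0/eqP] := w01 (V t).
Qed.

(** Multiplying by [g (V)] itself gives a centered square, to which [cmean0_ge0] applies. *)
Lemma cmean0_self V (g : T' -> R) : measurable_fun setT V ->
  measurable_fun setT g ->
  cmean0 P V (fun t => g (V t)) -> {ae P, forall t, g (V t) = 0}.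
Proof.
move=> mV mg cg.
have := @cmean0_ge0 V (fun t => g (V t) * g (V t)) mV (cmean0M mV mg cg).
move=> /(_ (fun t => sqr_ge0 _)); apply: filterS => t.
by move=> /eqP; rewrite mulf_eq0 orbb => /eqP.
Qed.

End cmean0_theory.

(** * Changing the conditioning variable *)

Section change_conditioning.
Context (d d1 d2 : measure_display) (T : measurableType d)
  (T1 : measurableType d1) (T2 : measurableType d2) (R : realType)
  (P : probability T R).

(** The tower property. The weight in [cmean0 P V f] depends on the finer [V], so a weight depending
    on [phi (V)] alone has to be supplied. *)
Lemma cmean0_comp (V : T -> T1) (phi : T1 -> T2) (f : T -> R) (w : T2 -> R) :
  measurable_fun setT V -> measurable_fun setT phi -> measurable_fun setT w ->
  (forall v, 0 < w v) ->
  P.-integrable setT (EFin \o (fun t => w (phi (V t)) * f t)) ->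
  cmean0 P V f -> cmean0 P (fun t => phi (V t)) f.
Proof.
move=> mV mphi mw w0 iw cf.
apply: (cmean0P (measurableT_comp mphi mV) mw w0 iw) => k mk ik.
exact: (cmean0_integral mV cf (measurableT_comp mk mphi) ik).
Qed.

(** Where [b] is nonzero, [psi] recovers [V] from [phi (V)], so the weight is there a function of
    [phi (V)]; elsewhere the product is 0. The intended case removes the treatment from the
    conditioning on the event that it equals a fixed value. *)
Lemma cmean0_section (V : T -> T1) (phi : T1 -> T2) (psi : T2 -> T1)
    (b : T1 -> R) (f : T -> R) :
  measurable_fun setT V -> measurable_fun setT phi -> measurable_fun setT psi ->
  measurable_fun setT b -> (forall v, b v != 0 -> psi (phi v) = v) ->
  cmean0 P V f -> cmean0 P (fun t => phi (V t)) (fun t => b (V t) * f t).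
Proof.
move=> mV mphi mpsi mb bK cf.
have cbf := cmean0M mV mb cf; have [w [mw w01 iw _]] := cbf.
apply: (cmean0_comp mV mphi (measurableT_comp mw mpsi)) cbf.
  by move=> v /=; have /andP[] := w01 (psi v).
apply: eq_integrable iw => // t _ /=.
have [->|b0] := eqVneq (b (V t)) 0; first by rewrite !mul0r !mulr0.
by rewrite bK.
Qed.

(** Dynkin's argument: rectangles form a pi-system generating the product sigma-algebra, and the
    sets over whose preimage [f] integrates to 0 are stable under complements and countable disjoint
    unions. *)
Lemma cmean0_pair (V : T -> T1) (W : T -> T2) (f : T -> R) :
  measurable_fun setT V -> measurable_fun setT W ->
  P.-integrable setT (EFin \o f) ->
  (forall B C, measurable B -> measurable C ->
     (\int[P]_(t in V @^-1` B `&` W @^-1` C) (f t)%:E = 0)%E) ->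
  cmean0 P (fun t => (V t, W t)) f.
Proof.
move=> mV mW intf f0.
have mVW : measurable_fun setT (fun t => (V t, W t)) by exact: measurable_fun_pair.
apply: cmean0_int => // D mD.
have mpre G : measurable G -> measurable ((fun t => (V t, W t)) @^-1` G).
  exact: measurable_preimage.
have intG G : measurable G ->
    P.-integrable ((fun t => (V t, W t)) @^-1` G) (EFin \o f).
  by move=> mG; apply: integrableS intf => //; exact: mpre.
have f0T : (\int[P]_t (f t)%:E = 0)%E.
  by have := f0 setT setT measurableT measurableT; rewrite !preimage_setT setIT.
apply: (@dynkin_induction _ _ [set A `*` B | A in measurable & B in measurable]
  (fun G => (\int[P]_(t in (fun t => (V t, W t)) @^-1` G) (f t)%:E = 0)%E)) => //.
- exact: measurable_prod_measurableType.
- move=> _ _ [A mA [B mB <-]] [A' mA' [B' mB' <-]].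
  exists (A `&` A'); first exact: measurableI.
  by exists (B `&` B'); [exact: measurableI|rewrite setXI].
- by move=> _ [A mA [B mB <-]]; exact: f0.
- move=> G mG G0.
  have : (\int[P]_(t in (fun t => (V t, W t)) @^-1` (G `|` ~` G)) (f t)%:E = 0)%E.
    by rewrite setUv preimage_setT.
  rewrite preimage_setU integral_setU//.
  + by rewrite G0 add0e.
  + exact: mpre.
  + exact: (mpre (~` G) (measurableC mG)).
  + rewrite -preimage_setU setUv preimage_setT.
    exact: measurable_int intf.
  + by rewrite -preimage_setC; apply/disj_setPCl.
- move=> F mF tF F0.
  rewrite preimage_bigcup integral_bigcup//.
  + by apply: eseries0 => i _ _; exact: F0.
  + apply/trivIsetP => i j _ _ ij; rewrite -preimage_setI.
    by move/trivIsetP : tF => /(_ i j Logic.I Logic.I ij) ->; rewrite preimage_set0.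
  + by move=> i; exact: (mpre (F i) (mF i)).
  + rewrite -preimage_bigcup; apply: intG.
    exact: bigcupT_measurable.
- by rewrite -measurable_prod_measurableType.
Qed.

End change_conditioning.

(** * From conditional expectations to centering relations *)

Section cexp_cmean0.
Context (d d' : measure_display) (T : measurableType d) (T' : measurableType d')
  (R : realType) (P : probability T R) (V : T -> T').
Hypothesis mV : measurable_fun setT V.

Lemma cexp_cmean0 (f : T -> R) : P.-integrable setT (EFin \o f) ->
  exists g : T' -> R, [/\ measurable_fun setT g,
    P.-integrable setT (EFin \o (g \o V)),
    forall t, cexp P V f t = g (V t) & cmean0 P V (fun t => f t - g (V t))].
Proof.
move=> intf; have [mg ig fg] := cexpP mV intf.
set g := xget _ _ in mg ig fg; exists g; split => //.
apply: cmean0_int => //; first exact: (integrableB measurableT intf ig).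
move=> C mC; have mVC := measurable_preimage mV mC.
under eq_integral do rewrite EFinB.
rewrite integralB_EFin//; [|exact: integrableS intf|exact: integrableS ig].
rewrite fg// subee//; apply: integrable_fin_num => //.
exact: integrableS intf.
Qed.

(** The factor [1 / P E] appears on both sides of the defining identity and cancels. Hypotheses
    stated under the laws given various events thus become centering relations under the single law
    [P], where they can be combined. *)
Lemma condlaw_cexp_cmean0 (E : set T) (f : T -> R) :
  measurable E -> P E != 0%E -> measurable_fun setT f ->
  P.-integrable setT (EFin \o (fun t => \1_E t * f t)) ->
  exists g : T' -> R, [/\ measurable_fun setT g,
    forall t, cexp (condlaw P E) V f t = g (V t) &
    cmean0 P V (fun t => \1_E t * (f t - g (V t)))].
Proof.
move=> mE PE mf i1f; have intf := (condlaw_integrable mE PE mf).2 i1f.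
have [mg ig fg] := cexpP mV intf.
set g := xget _ _ in mg ig fg; exists g; split => //.
have mgV : measurable_fun setT (g \o V) by exact: measurableT_comp.
have i1g := (condlaw_integrable mE PE mgV).1 ig.
apply: cmean0_int => //.
  apply: eq_integrable (integrableB measurableT i1f i1g) => // t _.
  by rewrite /= mulrBr.
move=> C mC; have mVC := measurable_preimage mV mC.
under eq_integral do rewrite mulrBr EFinB.
rewrite integralB_EFin//; [|exact: integrableS i1f|exact: integrableS i1g].
have := fg C mC; rewrite (integral_condlaw mE PE mVC mgV ig).
rewrite (integral_condlaw mE PE mVC mf intf) => /(congr1 (fun x => (fine (P E))%:E * x)%E).
rewrite !muleA -!EFinM mulfV ?mul1e; last first.
  by rewrite fine_eq0// fin_num_measure.
move=> ->; rewrite subee//; apply: integrable_fin_num => //.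
exact: integrableS i1f.
Qed.

End cexp_cmean0.

Lemma measurable_natr_bool (R : realType) d (T : measurableType d)
    (B : T -> bool) :
  measurable_fun setT B -> measurable_fun setT (fun t => (B t)%:R : R).
Proof.
move=> mB; have mb : measurable_fun setT (fun b : bool => b%:R : R) by [].
exact: (measurableT_comp mb mB).
Qed.

Lemma indic_bool (R : realType) T (E : set T) (b : bool) t :
  (E t <-> b) -> \1_E t = b%:R :> R.
Proof.
rewrite indicE; case: b => -[Eb bE]; first by rewrite mem_set//; exact: bE.
by rewrite memNset// => /Eb.
Qed.

(** * Positivity, supports and odds *)

Section observed.
Context (d d' : measure_display) (T : measurableType d) (T' : measurableType d')
  (R : realType) (P : probability T R) (V : T -> T').
Hypothesis mV : measurable_fun setT V.

(** Let [g (V)] be the conditional probability of [E]. As [V] avoids [N] on [E], the centered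
    [1_N(V) (1_E - g(V))] equals [- 1_N(V) g(V)] almost surely. Being a function of [V], it
    vanishes, and [g (V) > 0] leaves [1_N(V) = 0]. *)
Lemma cprob_support (E : set T) (N : set T') :
  measurable E -> {ae P, forall t, 0 < cprob P V E t} -> measurable N ->
  {ae P, forall t, E t -> ~ N (V t)} -> {ae P, forall t, ~ N (V t)}.
Proof.
move=> mE p0 mN EN.
have [g [mg _ gE cg]] := cexp_cmean0 mV (integrable_indic P mE).
have mN1 : measurable_fun setT (\1_N : T' -> R) by exact: measurable_indic.
have := cmean0M mV mN1 cg.
have mN1g : measurable_fun setT (fun v => - (\1_N v * g v)).
  by apply: measurable_funN; exact: measurable_funM.
move=> /(@cmean0_ae _ _ _ _ _ _ _ _ (fun t => - (\1_N (V t) * g (V t))) mV).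
move=> /(_ (measurableT_comp mN1g mV)) H.
have /(cmean0_self mV mN1g) : cmean0 P V (fun t => - (\1_N (V t) * g (V t))).
  apply: H; apply: filterS EN => t EN.
  rewrite mulrBr; have [Et|nE] := pselect (E t).
    by rewrite [\1_N _]indicE memNset ?mul0r ?subr0 ?oppr0//; exact: EN.
  by rewrite [\1_E _]indicE memNset// mulr0 sub0r.
apply: filterS2 p0 => t; rewrite /cprob gE => g0 /eqP.
rewrite oppr_eq0 mulf_eq0 (gt_eqF g0) orbF indicE pnatr_eq0 eqb0.
by move=> /negP NV NVt; apply: NV; exact: mem_set.
Qed.

Lemma cprob_gt0_measure (E F : set T) : measurable E -> measurable F ->
  E `<=` F -> {ae P, forall t, 0 < cprob P V E t} -> P F != 0%E.
Proof.
move=> mE mF EF p0; apply/eqP => F0.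
(* If [F] were null, so would be [E], and [cprob_support] with [N] the whole space would make the
   sample space null. *)
have /(cprob_support mE p0 measurableT) : {ae P, forall t, E t -> ~ [set: T'] (V t)}.
  by exists F; split => // t /= /not_implyP[/EF].
move=> [N [mN N0]]; rewrite (_ : ~` _ = setT); last first.
  by apply/seteqP; split => // t _ /= /(_ Logic.I).
rewrite subTset => NT; move: N0; rewrite NT probability_setT => /eqP.
by rewrite onee_eq0.
Qed.

(** The product of [f] with the indicator of [N] at [V] is nonnegative and centered, hence 0 almost
    surely. *)
Lemma cmean0_indic_le0 (f : T -> R) (N : set T') (Q : T -> Prop) :
  cmean0 P V f -> measurable N ->
  (forall t, N (V t) -> 0 <= f t) -> (forall t, N (V t) -> Q t -> 0 < f t) ->
  {ae P, forall t, Q t -> ~ N (V t)}.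
Proof.
move=> cf mN f0 Qf.
have mN1 : measurable_fun setT (\1_N : T' -> R) by exact: measurable_indic.
have := cmean0_ge0 mV (cmean0M mV mN1 cf).
move=> H; apply: filterS (H _) => [t + Qt NVt|t].
  by rewrite indicE mem_set// mul1r => ft0; have := Qf t NVt Qt; rewrite ft0 ltxx.
rewrite indicE; case: (boolP (V t \in N)) => [/set_mem/f0|_]; rewrite ?mul1r//.
by rewrite mul0r.
Qed.

(** Dividing [Y - p] by [1 - p] gives [Y - (p / (1 - p)) (1 - Y)], and [exp (logit p)] is this ratio
    when [0 < p < 1]. These bounds are proved first, because elsewhere [logit] takes conventional
    values; the support hypothesis for the two values of [Y] provides them. *)
Lemma odds_cmean0 (Y : T -> bool) (p l : T' -> R) :
  measurable_fun setT Y ->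
  (forall y N, measurable N -> {ae P, forall t, Y t = y -> ~ N (V t)} ->
     {ae P, forall t, ~ N (V t)}) ->
  measurable_fun setT p -> measurable_fun setT l ->
  cmean0 P V (fun t => (Y t)%:R - p (V t)) ->
  {ae P, forall t, logit (p (V t)) = l (V t)} ->
  cmean0 P V (fun t => (Y t)%:R - expR (l (V t)) * (1 - (Y t)%:R)).
Proof.
move=> mY supp mp ml cp pl.
(* Where [p (V) <= 0], the centered [Y - p (V)] is nonnegative, and positive if [Y] is true; so this
   set is avoided when [Y] is true, and [supp] removes it altogether. *)
have p_gt0 : {ae P, forall t, ~ (p (V t) <= 0)}.
  have mN : measurable [set v | p v <= 0].
    rewrite (_ : mkset _ = p @^-1` `]-oo, 0]); last by apply/seteqP; split=> v /=; rewrite in_itv.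
    exact: measurable_preimage.
  apply: (supp true _ mN).
  apply: (cmean0_indic_le0 cp mN) => t /= p0; first by rewrite subr_ge0 (le_trans p0).
  by move=> ->; rewrite subr_gt0 (le_lt_trans p0).
have p_lt1 : {ae P, forall t, ~ (1 <= p (V t))}.
  have mN : measurable [set v | 1 <= p v].
    rewrite (_ : mkset _ = p @^-1` `[1, +oo[); last first.
      by apply/seteqP; split=> v /=; rewrite in_itv/= andbT.
    exact: measurable_preimage.
  apply: (supp false _ mN).
  have mN1 : measurable_fun setT (cst (-1) : T' -> R) by exact: measurable_cst.
  have cp' := cmean0M mV mN1 cp.
  apply: (cmean0_indic_le0 cp' mN) => t /= p1.
    by rewrite /= mulN1r opprB subr_ge0 (le_trans _ p1)//; case: (Y t).
  by move=> ->; rewrite /= mulN1r opprB subr0 (lt_le_trans _ p1).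
have m1p : measurable_fun setT (fun v => (1 - p v)^-1).
  by apply: measurable_inv; exact: measurable_funB.
apply: cmean0_ae (cmean0M mV m1p cp) => //.
  have mYr := @measurable_natr_bool R _ _ _ mY.
  apply: measurable_funB => //; apply: measurable_funM; last exact: measurable_funB.
  by apply: measurableT_comp => //; exact: measurableT_comp.
apply: filterS3 p_gt0 p_lt1 pl => t /negP; rewrite -ltNge => p0 /negP.
rewrite -ltNge => p1 <-.
rewrite /logit lnK ?posrE ?divr_gt0 ?subr_gt0//.
have : 1 - p (V t) != 0 by rewrite subr_eq0 gt_eqF.
by move=> p1'; field.
Qed.

End observed.

(** Independence in the form [E[1_C(G) | V, F] = E[1_C(G) | V]]: the residual given [V] stays
    centered given the pair. *)
Lemma cindep_cmean0 d d1 d2 d3 (T : measurableType d) (T1 : measurableType d1)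
    (T2 : measurableType d2) (T3 : measurableType d3) (R : realType)
    (P : probability T R) (F : T -> T1) (G : T -> T2) (V : T -> T3) (C : set T2) :
  measurable_fun setT F -> measurable_fun setT G -> measurable_fun setT V ->
  cindep P F G V -> measurable C ->
  exists g : T3 -> R, [/\ measurable_fun setT g,
    cmean0 P V (fun t => \1_C (G t) - g (V t)) &
    cmean0 P (fun t => (V t, F t)) (fun t => \1_C (G t) - g (V t))].
Proof.
move=> mF mG mV FG mC.
have mGC := measurable_preimage mG mC.
have iGC : P.-integrable setT (EFin \o \1_(G @^-1` C)) by exact: integrable_indic.
have [g [mg ig gE cg]] := cexp_cmean0 mV iGC.
exists g; split => //.
have ifg : P.-integrable setT (EFin \o (fun t => \1_C (G t) - g (V t))).
  exact: (integrableB measurableT iGC ig).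
have mCg : measurable_fun setT (fun t => \1_C (G t) - g (V t)).
  exact/measurable_EFinP/(measurable_int _ ifg).
apply: cmean0_pair => // D B mD mB.
have mFB := measurable_preimage mF mB.
have iFB : P.-integrable setT (EFin \o \1_(F @^-1` B)) by exact: integrable_indic.
have [b [mb _ bE cb]] := cexp_cmean0 mV iFB.
have [e [me _ eE ce]] := cexp_cmean0 mV (integrable_indic P (measurableI _ _ mFB mGC)).
have mFB1 : measurable_fun setT (\1_(F @^-1` B) : T -> R) by exact: measurable_indic.
(* With [e = b g] from independence, [1_B (1_C - g) = (1_B 1_C - e) - g (1_B - b)], a combination of
   centered residuals. *)
have cBC : cmean0 P V (fun t => \1_(F @^-1` B) t * (\1_C (G t) - g (V t))).
  have := cmean0B mV ce (cmean0M mV mg cb).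
  apply: cmean0_ae => //; first exact: measurable_funM.
  apply: filterS (FG B C mB mC) => t.
  rewrite /cprob eE bE gE indicI /= => ->.
  rewrite -[\1_(G @^-1` C) t]/(\1_C (G t)).
  ring.
rewrite integral_indicM -[V @^-1` D]setTI integral_indicM.
have mD1 : measurable_fun setT (\1_D : T3 -> R) by exact: measurable_indic.
apply: (cmean0_integral mV cBC mD1).
apply: le_integrable_real ifg.
  apply: measurable_funM; first exact: measurableT_comp.
  exact: measurable_funM.
move=> t; rewrite mulrA normrM ler_piMl//.
rewrite !indicE; do 2 case: (_ \in _); rewrite ?mulr0 ?mul0r ?mulr1 ?normr1 ?normr0//.
Qed.

(** * Selection, the bridge function and removal of the treatment *)

Section proximal.
Context (R : realType) (d dX dU dW : measure_display) (T : measurableType d)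
  (TX : measurableType dX) (TU : measurableType dU) (TW : measurableType dW)
  (P : probability T R) (A Y S : T -> bool) (X : T -> TX) (U : T -> TU)
  (W : T -> TW).
Hypotheses (mA : measurable_fun setT A) (mY : measurable_fun setT Y)
  (mS : measurable_fun setT S) (mX : measurable_fun setT X)
  (mU : measurable_fun setT U) (mW : measurable_fun setT W).
Let UX t := (U t, X t).
Let AUX t := (A t, U t, X t).
Let PS := condlaw P [set t | S t = true].
Hypothesis positivity : forall a y : bool, {ae P, forall t,
  0 < cprob P UX [set t' | [/\ A t' = a, Y t' = y & S t' = true]] t}.

Let mUX : measurable_fun setT UX. Proof. exact: measurable_fun_pair. Qed.

Let mAUX : measurable_fun setT AUX.
Proof. by do 2 apply: measurable_fun_pair => //. Qed.

Let mAr a : measurable_fun setT (fun t => (A t == a)%:R : R).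
Proof.
have me : measurable_fun setT (fun b : bool => (b == a)%:R : R) by [].
exact: (measurableT_comp me mA).
Qed.

Let mYr : measurable_fun setT (fun t => (Y t)%:R : R).
Proof. exact: measurable_natr_bool. Qed.

Let mSr : measurable_fun setT (fun t => (S t)%:R : R).
Proof. exact: measurable_natr_bool. Qed.

Let mpsi a : measurable_fun setT (fun v : TU * TX => (a : bool, v.1, v.2)).
Proof. by do 2 apply: measurable_fun_pair => //. Qed.

Let mphi : measurable_fun setT (fun v : bool * TU * TX => (v.1.2, v.2)).
Proof.
apply: measurable_fun_pair => //.
exact: (measurableT_comp measurable_snd measurable_fst).
Qed.

Let measurable_event (B : T -> bool) b :
  measurable_fun setT B -> measurable [set t | B t = b].
Proof.
by move=> mB; rewrite (_ : mkset _ = B @^-1` [set b])//; exact: measurable_preimage.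
Qed.

Let measurable_event2 (B B' : T -> bool) b b' :
  measurable_fun setT B -> measurable_fun setT B' ->
  measurable [set t | B t = b /\ B' t = b'].
Proof. by move=> mB mB'; apply: measurableI; exact: measurable_event. Qed.

Let measurable_event3 a y :
  measurable [set t | [/\ A t = a, Y t = y & S t = true]].
Proof.
rewrite (_ : mkset _ = [set t | A t = a] `&` [set t | Y t = y /\ S t = true]).
  by apply: measurableI; [exact: measurable_event|exact: measurable_event2].
by apply/seteqP; split=> t [] => [? ? ?|? []].
Qed.

Let PS_neq0 : P [set t | S t = true] != 0%E.
Proof.
apply: (cprob_gt0_measure mUX (measurable_event3 true true) _ _ (positivity _ _)).
  exact: measurable_event.
by move=> t [].
Qed.

Let PYS_neq0 : P [set t | Y t = false /\ S t = true] != 0%E.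
Proof.
apply: (cprob_gt0_measure mUX (measurable_event3 true false) _ _ (positivity _ _)).
  exact: measurable_event2.
by move=> t [].
Qed.

Let PYA_neq0 y a : P [set t | Y t = y /\ A t = a] != 0%E.
Proof.
apply: (cprob_gt0_measure mUX (measurable_event3 a y) _ _ (positivity _ _)).
  exact: measurable_event2.
by move=> t [].
Qed.

(** Positivity is conditional on [(U, X)], whereas [N] involves [A] too; so [N] is sliced at each
    value [a]. A slice avoided on the event [A = a, Y = y, S = 1] is avoided almost surely. *)
Let AUX_support y (N : set (bool * TU * TX)) : measurable N ->
  {ae P, forall t, Y t = y -> S t -> ~ N (AUX t)} ->
  {ae P, forall t, ~ N (AUX t)}.
Proof.
move=> mN YN.
have H a : {ae P, forall t, ~ N (a, U t, X t)}.
  have mNa := measurable_preimage (mpsi a) mN.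
  apply: (cprob_support mUX (measurable_event3 a y) (positivity a y) mNa).
  by apply: filterS YN => t YN [At Yt St]; have := YN Yt St; rewrite /AUX At.
apply: filterS2 (H true) (H false) => t HT HF; rewrite /AUX.
by case: (A t).
Qed.

Lemma cmean0_treatment a f : cmean0 P AUX f ->
  cmean0 P UX (fun t => (A t == a)%:R * f t).
Proof.
move=> cf.
have mb : measurable_fun setT (fun v : bool * TU * TX => (v.1.1 == a)%:R : R).
  have me : measurable_fun setT (fun b : bool => (b == a)%:R : R) by [].
  apply: (measurableT_comp me).
  exact: (measurableT_comp measurable_fst measurable_fst).
apply: (cmean0_section mAUX mphi (mpsi a) mb _ cf) => -[[a' u] x] /=.
by have [->//|_] := eqVneq a' a; rewrite eqxx.
Qed.

(** Let [s1] and [s0] be the selection probabilities given [Y = 1] and [Y = 0]. The odds relation is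
    multiplied by [s1], and the residuals [S - s1] and [S - s0], on [Y = 1] and [Y = 0], bring in
    [S]. The equality [s1 = xi s0] cancels the terms without [S]. *)
Lemma selected_odds beta0 (eta xi : TU * TX -> R) a :
  measurable_fun setT eta -> measurable_fun setT xi -> (forall v, 0 < xi v) ->
  {ae P, forall t, logit (cprob P AUX [set t' | Y t' = true] t)
    = beta0 * (A t)%:R + eta (U t, X t)} ->
  {ae P, forall t,
     cprob (condlaw P [set t' | Y t' = true /\ A t' = a]) UX
           [set t' | S t' = true] t
     / cprob (condlaw P [set t' | Y t' = false /\ A t' = a]) UX
             [set t' | S t' = true] t
     = xi (U t, X t)} ->
  cmean0 P UX (fun t => (A t == a)%:R * (S t)%:R * ((Y t)%:R -
    xi (UX t) * expR (beta0 * a%:R + eta (UX t)) * (1 - (Y t)%:R))).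
Proof.
move=> meta mxi xi_gt0 model sel.
have mEY b := measurable_event b mY.
have [p [mp _ pE cp]] := cexp_cmean0 mAUX (integrable_indic P (mEY true)).
pose l (v : bool * TU * TX) := beta0 * v.1.1%:R + eta (v.1.2, v.2).
have ml : measurable_fun setT l.
  apply: measurable_funD; last exact: (measurableT_comp meta mphi).
  apply: measurable_funM => //; apply: measurable_natr_bool.
  exact: (measurableT_comp measurable_fst measurable_fst).
have Y1 b t : \1_[set t' | Y t' = b] t = (Y t == b)%:R :> R.
  by apply: indic_bool; split=> /eqP.
have cpY : cmean0 P AUX (fun t => (Y t)%:R - p (AUX t)).
  rewrite (_ : (fun _ => _) = (fun t => \1_[set t' | Y t' = true] t - p (AUX t)))//.
  by apply/funext => t; rewrite Y1 eqb_id.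
have mpl : {ae P, forall t, logit (p (AUX t)) = l (AUX t)}.
  by apply: filterS model => t; rewrite /cprob pE.
have supp y N : measurable N -> {ae P, forall t, Y t = y -> ~ N (AUX t)} ->
    {ae P, forall t, ~ N (AUX t)}.
  move=> mN YN; apply: (@AUX_support y) => //.
  by apply: filterS YN => t YN Yt _; exact: YN.
have odds := cmean0_treatment a (odds_cmean0 mAUX mY supp mp ml cpY mpl).
have iYAS y : P.-integrable setT (EFin \o (fun t =>
    \1_[set t' | Y t' = y /\ A t' = a] t * \1_[set t' | S t' = true] t)).
  rewrite (_ : (fun _ => _) =
    \1_([set t' | Y t' = y /\ A t' = a] `&` [set t' | S t' = true])).
    apply: integrable_indic; apply: measurableI; first exact: measurable_event2.
    exact: measurable_event.
  by apply/funext => t; rewrite indicI.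
have mS1 : measurable_fun setT (\1_[set t' | S t' = true] : T -> R).
  by apply: measurable_indic; exact: measurable_event.
have [s1 [ms1 s1E cs1]] := condlaw_cexp_cmean0 mUX
  (measurable_event2 true a mY mA) (PYA_neq0 _ _) mS1 (iYAS true).
have [s0 [ms0 s0E cs0]] := condlaw_cexp_cmean0 mUX
  (measurable_event2 false a mY mA) (PYA_neq0 _ _) mS1 (iYAS false).
pose e v := expR (beta0 * a%:R + eta v).
have me : measurable_fun setT e.
  by apply: measurableT_comp => //; exact: measurable_funD.
have mxe : measurable_fun setT (fun v => xi v * e v) by exact: measurable_funM.
have := cmean0B mUX (cmean0D mUX cs1 (cmean0M mUX ms1 odds)) (cmean0M mUX mxe cs0).
apply: cmean0_ae => //.
  apply: measurable_funM; first exact: measurable_funM.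
  apply: measurable_funB => //; apply: measurable_funM.
    exact: (measurableT_comp mxe mUX).
  exact: measurable_funB.
apply: filterS sel => t; rewrite /cprob s1E s0E -/(UX t) => s10.
(* A zero denominator would make the quotient 0 by convention, against [xi > 0]. *)
have s0n0 : s0 (UX t) != 0.
  apply/eqP => s00; have := xi_gt0 (UX t); rewrite -s10 s00 invr0 mulr0.
  by rewrite ltxx.
have -> : s1 (UX t) = xi (UX t) * s0 (UX t) by rewrite -s10 divfK.
rewrite /l /e /= -/(UX t).
have S1 : \1_[set t' | S t' = true] t = (S t)%:R :> R by exact: indic_bool.
have YA1 y : \1_[set t' | Y t' = y /\ A t' = a] t = (Y t == y)%:R * (A t == a)%:R :> R.
  rewrite -natrM mulnb; apply: indic_bool.
  by split=> [[/eqP-> /eqP->]|/andP[/eqP ? /eqP ?]].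
rewrite S1 !YA1 -[1 - _]/(1 - (Y t)%:R).
have [->|] := eqVneq (A t) a; last by rewrite !(mulr0, mul0r) subr0 addr0.
by case: (Y t) => /=; ring.
Qed.

(** Let [q] be the bridge expectation and [g1], [g0] the outcome probabilities given [S = 1]. In [S
    (1_{Y=1} - g1) - q S (1_{Y=0} - g0) - S 1_{Y=0} (h - q)] the bridge equation [g1 = q g0] leaves
    [S (Y - (1 - Y) h)]. This is centered given [(A, U, X)], and is then restricted to [A = a]. *)
Lemma bridge_cmean0 (h : bool * TW * TX -> R) a :
  measurable_fun setT h ->
  (forall a, P.-integrable setT
     (EFin \o (fun t => (S t)%:R * ((1 - (Y t)%:R) * h (a, W t, X t))))) ->
  {ae P, forall t,
     cexp (condlaw P [set t' | Y t' = false /\ S t' = true]) AUX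
          (fun t' => h (A t', W t', X t')) t
     = cprob PS AUX [set t' | Y t' = true] t
       / cprob PS AUX [set t' | Y t' = false] t} ->
  cmean0 P UX (fun t => (A t == a)%:R * (S t)%:R *
    ((Y t)%:R - (1 - (Y t)%:R) * h (a, W t, X t))).
Proof.
move=> mh ih bridge.
have mhA : measurable_fun setT (fun t => h (A t, W t, X t)).
  by apply: (measurableT_comp mh); do 2 apply: measurable_fun_pair => //.
have mEY b := measurable_event b mY.
have mES := measurable_event true mS.
have mEYS := measurable_event2 false true mY mS.
have Y1 b t : \1_[set t' | Y t' = b] t = (Y t == b)%:R :> R.
  by apply: indic_bool; split=> /eqP.
have S1 t : \1_[set t' | S t' = true] t = (S t)%:R :> R by exact: indic_bool.
have YS1 t : \1_[set t' | Y t' = false /\ S t' = true] t = (1 - (Y t)%:R) * (S t)%:R :> R.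
  rewrite (_ : 1 - (Y t)%:R = (~~ Y t)%:R); last by case: (Y t); rewrite ?subrr ?subr0.
  rewrite -natrM mulnb; apply: indic_bool.
  by split=> [[-> ->]|/andP[/negbTE ? ?]].
have iSY b : P.-integrable setT (EFin \o (fun t =>
    \1_[set t' | S t' = true] t * \1_[set t' | Y t' = b] t)).
  rewrite (_ : (fun _ => _) = \1_([set t' | S t' = true] `&` [set t' | Y t' = b])).
    by apply: integrable_indic; exact: measurableI.
  by apply/funext => t; rewrite indicI.
have mY1 b : measurable_fun setT (\1_[set t' | Y t' = b] : T -> R).
  exact: measurable_indic.
have [g1 [mg1 g1E cg1]] := condlaw_cexp_cmean0 mAUX mES PS_neq0 (mY1 true) (iSY true).
have [g0 [mg0 g0E cg0]] := condlaw_cexp_cmean0 mAUX mES PS_neq0 (mY1 false) (iSY false).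
(* The treatment has two values, so [|h (A, W, X)|] is at most the sum of [|h (a, W, X)|] over
   both. *)
have iYSh : P.-integrable setT (EFin \o (fun t =>
    \1_[set t' | Y t' = false /\ S t' = true] t * h (A t, W t, X t))).
  apply: le_integrable_real (integrableD measurableT
    (integrable_norm (ih true)) (integrable_norm (ih false))).
    by apply: measurable_funM => //; exact: measurable_indic.
  move=> t /=; rewrite YS1 [X in _ <= X]ger0_norm ?addr_ge0//.
  rewrite [_ * (S t)%:R]mulrC -mulrA.
  by case: (A t); rewrite ?lerDl ?lerDr normr_ge0.
have [q [mq qE cq]] := condlaw_cexp_cmean0 mAUX mEYS PYS_neq0 mhA iYSh.
(* This clears the denominator. Where [g0 = 0], the residual [S (1_{Y=0} - g0)] is the indicator of
   [Y = 0, S = 1]; so that event avoids this set, and [AUX_support] removes it. *)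
have g0_neq0 : {ae P, forall t, ~ (g0 (AUX t) = 0)}.
  have mN : measurable [set v | g0 v = 0].
    rewrite (_ : mkset _ = g0 @^-1` [set 0])//; exact: measurable_preimage.
  apply: (@AUX_support false _ mN).
  have := @cmean0_indic_le0 _ _ _ _ _ P AUX mAUX _ [set v | g0 v = 0]
    (fun t => Y t = false /\ S t) cg0 mN.
  move=> H; have : {ae P, forall t, Y t = false /\ S t -> ~ [set v | g0 v = 0] (AUX t)}.
    apply: H => t /= ->; rewrite subr0 S1 Y1 ?mulr_ge0//.
    by move=> [-> ->]; rewrite mulr1.
  by apply: filterS => t Ht Yt St; exact: Ht.
have cAUX : cmean0 P AUX (fun t => (S t)%:R * ((Y t)%:R - (1 - (Y t)%:R) * h (A t, W t, X t))).
  have := cmean0B mAUX (cmean0B mAUX cg1 (cmean0M mAUX mq cg0)) cq.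
  apply: cmean0_ae => //.
    apply: measurable_funM => //; apply: measurable_funB => //.
    by apply: measurable_funM => //; exact: measurable_funB.
  apply: filterS2 g0_neq0 bridge => t /eqP g00.
  rewrite /cprob qE g1E g0E => qg.
  have -> : g1 (AUX t) = q (AUX t) * g0 (AUX t) by rewrite qg divfK.
  by rewrite YS1 S1 !Y1; case: (Y t) => /=; ring.
apply: cmean0_ae (cmean0_treatment a cAUX) => //.
  apply: measurable_funM; first exact: measurable_funM.
  apply: measurable_funB => //; apply: measurable_funM.
    exact: measurable_funB.
  by apply: (measurableT_comp mh); do 2 apply: measurable_fun_pair => //.
apply: aeW => t; have [->|_] := eqVneq (A t) a; last by rewrite !mul0r.
by rewrite mulrA.
Qed.

(** Let [M] be the function to be centered and [g] the probability of [A = a] given [(U, X, Y, S)].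
    As [M] is a function of [(U, X, Y, S, W)], independence makes [M (1_{A=a} - g)] centered.
    Subtracting it from the hypothesis leaves [al (U, X) M], which is divided by [al]. *)
Lemma cmean0_drop_treatment (h : bool * TW * TX -> R) (r : TU * TX -> R) a :
  measurable_fun setT h -> measurable_fun setT r ->
  cindep P W A (fun t => (U t, X t, Y t, S t)) ->
  P.-integrable setT
    (EFin \o (fun t => (S t)%:R * ((1 - (Y t)%:R) * h (a, W t, X t)))) ->
  cmean0 P UX (fun t => (A t == a)%:R * (S t)%:R *
    ((1 - (Y t)%:R) * (h (a, W t, X t) - r (UX t)))) ->
  cmean0 P UX (fun t => (S t)%:R *
    ((1 - (Y t)%:R) * (h (a, W t, X t) - r (UX t)))).
Proof.
move=> mh mr WA ih ch.
set V := (fun t => (U t, X t, Y t, S t)) in WA.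
have mV : measurable_fun setT V by do 3 apply: measurable_fun_pair => //.
have mVW : measurable_fun setT (fun t => (V t, W t)) by exact: measurable_fun_pair.
have ma1 : measurable [set a] by [].
have [g [mg cg cgW]] := cindep_cmean0 mW mA mV WA ma1.
have A1 t : \1_[set a] (A t) = (A t == a)%:R :> R.
  by apply: indic_bool; split=> /eqP.
(* The function to be centered vanishes unless [Y = 0] and [S = 1], so [g] matters only there; with
   these values inserted it depends on [(U, X)] alone. *)
pose al (v : TU * TX) := g (v, false, true).
have mal : measurable_fun setT al.
  by apply: (measurableT_comp mg); do 2 apply: measurable_fun_pair => //.
pose fst3 (v : TU * TX * bool * bool * TW) := v.1.1.1.
have mfst3 : measurable_fun setT fst3.
  apply: (measurableT_comp measurable_fst).
  exact: (measurableT_comp measurable_fst measurable_fst).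
pose m (v : TU * TX * bool * bool * TW) : R :=
  v.1.2%:R * ((1 - v.1.1.2%:R) * (h (a, v.2, v.1.1.1.2) - r (fst3 v))).
have mm : measurable_fun setT m.
  have m1 : measurable_fun setT (fun v : TU * TX * bool * bool * TW => v.1.2).
    exact: (measurableT_comp measurable_snd measurable_fst).
  have m2 : measurable_fun setT (fun v : TU * TX * bool * bool * TW => v.1.1.2).
    apply: (measurableT_comp measurable_snd).
    exact: (measurableT_comp measurable_fst measurable_fst).
  have m3 : measurable_fun setT (fun v : TU * TX * bool * bool * TW => v.1.1.1.2).
    exact: (measurableT_comp measurable_snd mfst3).
  apply: measurable_funM; first exact: measurable_natr_bool.
  apply: measurable_funM.
    by apply: measurable_funB => //; exact: measurable_natr_bool.
  apply: measurable_funB; last exact: measurableT_comp.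
  by apply: (measurableT_comp mh); do 2 apply: measurable_fun_pair => //.
(* The coarser conditioning on [(U, X)] requires a weight in [(U, X)]. This one offsets the bound
   [|h - r| |1_{A=a} - al| <= (1 + |r|) (|h| + 1) (1 + |al|)] and leaves [|h| + 1], integrable over
   [Y = 0, S = 1]. *)
pose u v := ((1 + `|al v|) * (1 + `|r v|))^-1.
have al1 v : 0 < 1 + `|al v| by rewrite ltr_pwDl.
have r1 v : 0 < 1 + `|r v| by rewrite ltr_pwDl.
have mu : measurable_fun setT u.
  apply: measurable_inv; apply: measurable_funM; apply: measurable_funD => //;
    exact: measurableT_comp.
have u0 v : 0 < u v by rewrite invr_gt0 mulr_gt0.
have cm := cmean0M mVW mm cgW.
have mcm := cmean0_measurable mVW cm.
have iu : P.-integrable setT (EFin \o (fun t => u (fst3 (V t, W t)) *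
    (m (V t, W t) * (\1_[set a] (A t) - g (V t))))).
  have i1 := finite_measure_integrable_cst P 1 measurableT.
  apply: le_integrable_real (integrableD measurableT (integrable_norm ih) i1).
    apply: measurable_funM => //.
    exact: (measurableT_comp mu mUX).
  move=> t /=; rewrite [X in _ <= X]ger0_norm ?addr_ge0// A1 /m /V /fst3/=.
  have [[St Yt]|SY] := pselect (S t = true /\ Y t = false); last first.
    rewrite [X in u _ * X](_ : _ = 0) ?mulr0 ?normr0 ?addr_ge0//.
    by move: SY; case: (S t); case: (Y t) => //= SY;
      rewrite ?subrr ?(mul0r, mulr0)//; case: SY.
  rewrite St Yt /= subr0 !mul1r -/(al (U t, X t)) -/(UX t).
  rewrite normrM gtr0_norm// ler_pdivrMl ?mulr_gt0// normrM.
  set x := h _; set y := r _; set z := al _.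
  have hr : `|x - y| <= (1 + `|y|) * (`|x| + 1).
    rewrite (le_trans (ler_normB _ _))// mulrDl mul1r mulrDr mulr1 -addrA lerD2l.
    by rewrite addrA lerDr addr_ge0// mulr_ge0.
  have az : `|(A t == a)%:R - z| <= 1 + `|z|.
    rewrite (le_trans (ler_normB _ _))// lerD2r.
    by case: (A t == a); rewrite ?normr1 ?normr0.
  rewrite (le_trans (ler_pM _ _ hr az))//.
  by rewrite le_eqVlt; apply/orP; left; apply/eqP; ring.
have cUX := cmean0_comp mVW mfst3 mu u0 iu cm.
(* Where [al = 0], [Y = 0] and [S = 1], the residual [1_{A=a} - g] is the indicator of [A = a]; so
   [A = a] excludes this set, and positivity of [A = a, Y = 0, S = 1] does the rest. *)
have al_neq0 : {ae P, forall t, ~ (al (UX t) = 0)}.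
  have mN : measurable [set v | al v = 0].
    rewrite (_ : mkset _ = al @^-1` [set 0])//; exact: measurable_preimage.
  have mN' : measurable [set v : TU * TX * bool * bool | [/\ al v.1.1 = 0, v.1.2 = false & v.2 = true]].
    rewrite (_ : mkset _ = (fun v : TU * TX * bool * bool => al v.1.1) @^-1` [set 0]
      `&` ((fun v : TU * TX * bool * bool => v.1.2) @^-1` [set false]
      `&` snd @^-1` [set true])); last first.
      by apply/seteqP; split=> v /= [] => [? ? ?|? []].
    apply: measurableI.
      apply: measurable_preimage => //; apply: (measurableT_comp mal).
      exact: (measurableT_comp measurable_fst measurable_fst).
    apply: measurableI; apply: measurable_preimage => //.
    exact: (measurableT_comp measurable_snd measurable_fst).
  apply: (cprob_support mUX (measurable_event3 a false) (positivity a false) mN).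
  have := @cmean0_indic_le0 _ _ _ _ _ P V mV _ _ (fun t => A t = a) cg mN'.
  move=> H; have : {ae P, forall t, A t = a ->
     ~ [set v : TU * TX * bool * bool | [/\ al v.1.1 = 0, v.1.2 = false & v.2 = true]] (V t)}.
    apply: H => t /= [+ Yt St]; rewrite A1 /al /V Yt St /= => ->; rewrite subr0//.
    by move=> ->; rewrite eqxx.
  by apply: filterS => t Ht [At Yt St] al0; apply: (Ht At); split.
have mai : measurable_fun setT (fun v => (al v)^-1) by exact: measurable_inv.
apply: cmean0_ae (cmean0M mUX mai (cmean0B mUX ch cUX)) => //.
  apply: measurable_funM => //; apply: measurable_funM; first exact: measurable_funB.
  apply: measurable_funB; last exact: (measurableT_comp mr mUX).
  by apply: (measurableT_comp mh); do 2 apply: measurable_fun_pair => //.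
apply: filterS al_neq0 => t /eqP al0; rewrite A1 /m /V /fst3/= -/(UX t).
have [[St Yt]|SY] := pselect (S t = true /\ Y t = false).
  rewrite St Yt /= -/(al (UX t)).
  by field.
by move: SY; case: (S t); case: (Y t) => //= SY; 
  rewrite ?subrr ?(mul0r, mulr0, subrr)//; case: SY.
Qed.

(** Square-integrability of both factors makes the product with [c (X)] integrable, so that
    conditional centering given [(U, X)] turns into a mean equal to 0. *)
Lemma proximal_moment beta0 (eta xi : TU * TX -> R)
    (h : bool * TW * TX -> R) (c : TX -> R) :
  measurable_fun setT eta ->
  {ae P, forall t, logit (cprob P AUX [set t' | Y t' = true] t)
    = beta0 * (A t)%:R + eta (U t, X t)} ->
  measurable_fun setT xi -> (forall v, 0 < xi v) ->
  (forall a, {ae P, forall t,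
     cprob (condlaw P [set t' | Y t' = true /\ A t' = a]) UX
           [set t' | S t' = true] t
     / cprob (condlaw P [set t' | Y t' = false /\ A t' = a]) UX
             [set t' | S t' = true] t
     = xi (U t, X t)}) ->
  cindep P W A (fun t => (U t, X t, Y t, S t)) ->
  measurable_fun setT h ->
  (forall a,
     (fun t => (1 - (Y t)%:R) * h (a, W t, X t)) \in Lfun PS 2%:E) ->
  {ae P, forall t,
     cexp (condlaw P [set t' | Y t' = false /\ S t' = true]) AUX
          (fun t' => h (A t', W t', X t')) t
     = cprob PS AUX [set t' | Y t' = true] t
       / cprob PS AUX [set t' | Y t' = false] t} ->
  measurable_fun setT c -> (fun t => c (X t)) \in Lfun PS 2%:E ->
  ('E_PS[(fun t => c (X t) * (1 - (Y t)%:R)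
                   * (h (true, W t, X t) * expR (- beta0)
                      - h (false, W t, X t)))%R] = 0)%E.
Proof.
move=> meta model mxi xi_gt0 sel WA mh h2 bridge mc c2.
have mES := measurable_event true mS.
have S1 t : \1_[set t' | S t' = true] t = (S t)%:R :> R by exact: indic_bool.
have mha a : measurable_fun setT (fun t => h (a, W t, X t)).
  by apply: (measurableT_comp mh); do 2 apply: measurable_fun_pair => //.
have m1Y : measurable_fun setT (fun t => 1 - (Y t)%:R : R).
  exact: measurable_funB.
have mYh a : measurable_fun setT (fun t => (1 - (Y t)%:R) * h (a, W t, X t)).
  exact: measurable_funM.
have mcX : measurable_fun setT (fun t => c (X t)) by exact: measurableT_comp.
have mcYh a : measurable_fun setT (fun t => c (X t) * ((1 - (Y t)%:R) * h (a, W t, X t))).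
  exact: measurable_funM.
have ih a : P.-integrable setT
    (EFin \o (fun t => (S t)%:R * ((1 - (Y t)%:R) * h (a, W t, X t)))).
  have /Lfun1_integrable : (fun t => (1 - (Y t)%:R) * h (a, W t, X t)) \in Lfun PS 1.
    by apply: (Lfun_subset12 _ (h2 a)); exact: fin_num_measure.
  move=> /(condlaw_integrable mES PS_neq0 (mYh a)).
  by apply: eq_integrable => // t _; rewrite /= S1.
have ichPS a : PS.-integrable setT
    (EFin \o (fun t => c (X t) * ((1 - (Y t)%:R) * h (a, W t, X t)))).
  exact/Lfun1_integrable/(Lfun2_mul_Lfun1 c2 (h2 a)).
have ich a : P.-integrable setT
    (EFin \o (fun t => (S t)%:R * (c (X t) * ((1 - (Y t)%:R) * h (a, W t, X t))))).
  have := ichPS a; move=> /(condlaw_integrable mES PS_neq0 (mcYh a)).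
  by apply: eq_integrable => // t _; rewrite /= S1.
pose r a v := xi v * expR (beta0 * a%:R + eta v).
have mr a : measurable_fun setT (r a).
  apply: measurable_funM => //; apply: measurableT_comp => //.
  exact: measurable_funD.
(* The terms [S Y] of the odds and bridge relations cancel, which leaves [(1 - Y) (h - r a)]. *)
have ch (a : bool) : cmean0 P UX (fun t => (S t)%:R *
    ((1 - (Y t)%:R) * (h (a, W t, X t) - r a (UX t)))).
  apply: (cmean0_drop_treatment mh (mr a) WA (ih a)).
  have := cmean0B mUX (selected_odds meta mxi xi_gt0 model (sel a))
    (bridge_cmean0 a mh ih bridge).
  apply: cmean0_ae => //; last by apply: aeW => t; rewrite /r; ring.
  apply: measurable_funM; first exact: measurable_funM.
  apply: measurable_funM => //; apply: measurable_funB => //.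
  exact: (measurableT_comp (mr a) mUX).
have cdiff : cmean0 P UX (fun t => (S t)%:R * ((1 - (Y t)%:R) *
    (h (true, W t, X t) * expR (- beta0) - h (false, W t, X t)))).
  have me : measurable_fun setT (cst (expR (- beta0)) : TU * TX -> R).
    exact: measurable_cst.
  have := cmean0B mUX (cmean0M mUX me (ch true)) (ch false).
  apply: cmean0_ae => //.
    apply: measurable_funM => //; apply: measurable_funM => //.
    by apply: measurable_funB => //; exact: measurable_funM.
  apply: aeW => t; rewrite /r /= mulr1 mulr0 add0r expRD.
  have eN : expR (- beta0) * expR beta0 = 1 by rewrite expRN mulVf// gt_eqF// expR_gt0.
  (* The two sides agree identically up to a multiple of [1 - exp(-beta0) exp(beta0)], which [eN]
     shows to be 0. *)
  rewrite [RHS](_ : _ = (S t)%:R * ((1 - (Y t)%:R) *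
    (h (true, W t, X t) * expR (- beta0) - h (false, W t, X t)))
    + (S t)%:R * (1 - (Y t)%:R) * xi (UX t) * expR (eta (UX t)) *
      (1 - expR (- beta0) * expR beta0)); first by ring.
  by rewrite eN; ring.
have mcs : measurable_fun setT (fun v : TU * TX => c v.2).
  exact: (measurableT_comp mc measurable_snd).
pose m t := c (X t) * (1 - (Y t)%:R) *
  (h (true, W t, X t) * expR (- beta0) - h (false, W t, X t)).
have mE t : m t = expR (- beta0) * (c (X t) * ((1 - (Y t)%:R) * h (true, W t, X t)))
    - c (X t) * ((1 - (Y t)%:R) * h (false, W t, X t)).
  by rewrite /m; ring.
have imPS : PS.-integrable setT (EFin \o m).
  have := integrableB measurableT
    (integrableZl measurableT (expR (- beta0)) (ichPS true)) (ichPS false).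
  by apply: eq_integrable => // t _; rewrite /= mE EFinB EFinM.
have mm : measurable_fun setT m by exact/measurable_EFinP/(measurable_int _ imPS).
have im := (condlaw_integrable mES PS_neq0 mm).1 imPS.
rewrite unlock -/m (integral_condlaw mES PS_neq0 measurableT mm imPS).
rewrite [X in (_ * X)%E](_ : _ = 0%E) ?mule0//.
have cE t : \1_[set t' | S t' = true] t * m t = c (UX t).2 * ((S t)%:R * ((1 - (Y t)%:R) *
    (h (true, W t, X t) * expR (- beta0) - h (false, W t, X t)))).
  by rewrite S1 /m /=; ring.
under eq_integral do rewrite cE.
apply: (cmean0_integral mUX cdiff mcs).
by apply: eq_integrable im => // t _; rewrite /= cE.
Qed.

End proximal.

Theorem theorem4 (R : realType) (d : measure_display) (T : measurableType d)
    (P : probability T R) (nX nU nZ nW : nat)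
    (A Y S : {RV P >-> bool})
    (X : {RV P >-> nX.-tuple R}) (U : {RV P >-> nU.-tuple R})
    (Z : {RV P >-> nZ.-tuple R}) (W : {RV P >-> nW.-tuple R})
    (beta0 : R)
    (eta xi : nU.-tuple R * nX.-tuple R -> R)
    (h : bool * nW.-tuple R * nX.-tuple R -> R)
    (c : nX.-tuple R -> R)
    (UX := fun w => (U w, X w))
    (AUX := fun w => (A w, U w, X w))
    (PS := condlaw P [set w | S w = true])
    (* positivity *)
    (Hpos : forall a y : bool, {ae P, forall w,
       0 < cprob P UX [set w' | [/\ A w' = a, Y w' = y & S w' = true]] w})
    (* homogeneous odds ratio model *)
    (meta : measurable_fun setT eta)
    (Hmodel : {ae P, forall w,
       logit (cprob P AUX [set w' | Y w' = true] w)
         = beta0 * (A w)%:R + eta (U w, X w)})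
    (* no effect modification by A on the outcome-dependent selection *)
    (mxi : measurable_fun setT xi)
    (xi_gt0 : forall ux, 0 < xi ux)
    (Hsel : forall a : bool, {ae P, forall w,
       cprob (condlaw P [set w' | Y w' = true /\ A w' = a]) UX
             [set w' | S w' = true] w
       / cprob (condlaw P [set w' | Y w' = false /\ A w' = a]) UX
               [set w' | S w' = true] w
         = xi (U w, X w)})
    (* proximal independence *)
    (HW : cindep P W A (fun w => (U w, X w, Y w, S w)))
    (HZ : cindep P Z (fun w => (Y w, W w, S w)) AUX)
    (* outcome confounding bridge function *)
    (mh : measurable_fun setT h)
    (h_L2 : forall a : bool,
       (fun w => (1 - (Y w)%:R) * h (a, W w, X w)) \in Lfun PS 2%:E)
    (Hbridge : {ae P, forall w,
       cexp (condlaw P [set w' | Y w' = false /\ S w' = true]) AUX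
            (fun w' => h (A w', W w', X w')) w
         = cprob PS AUX [set w' | Y w' = true] w
           / cprob PS AUX [set w' | Y w' = false] w})
    (mc : measurable_fun setT c)
    (c_L2 : (fun w => c (X w)) \in Lfun PS 2%:E)
    (Hc : forall a : bool,
       ('E_PS[(fun w => c (X w) * (1 - (Y w)%:R) * h (a, W w, X w))%R] <> 0)%E) :
  ('E_PS[(fun w => c (X w) * (1 - (Y w)%:R)
                   * (h (true, W w, X w) * expR (- beta0)
                      - h (false, W w, X w)))%R] = 0)%E.
Proof.
apply: (@proximal_moment R d _ _ _ T _ _ _ P A Y S X U W _ _ _ _ _ _ Hpos
  beta0 eta xi h c meta Hmodel mxi xi_gt0 Hsel HW mh h_L2 Hbridge mc c_L2);
  exact: measurable_funPT.
Qed.
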